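(* Let $A$ be a unital Banach $\star$-algebra with unity $1$, let $z \in A$ be fixed, let $X$ be a Banach space, and let $\phi : A \times A \to X$ be a continuous bilinear map. Suppose that $\phi$ satisfies at least one of the following conditions: (i) $\phi(a, b^\star) = \phi(1, z)$ for all $a, b \in A$ with $a b^\star = z$; (ii) $\phi(a^\star, b) = \phi(1, z)$ for all $a, b \in A$ with $a^\star b = z$. Then \[ \phi(a, az) = \phi(1, a^2 z) \quad \text{and} \quad \phi(1, az) = \phi(a, z) \quad \text{for all } a \in A, \] and there exists a continuous linear map $\Phi : A \to X$ such that \[ \phi(a, bz) + \phi(b, az) = \Phi(a \circ b) \quad \text{for all } a, b \in A. \]
   Context: Algebras and Banach spaces are over $\mathbb{C}$; $a \mapsto a^\star$ denotes the involution of $A$ (conjugate-linear, anti-multiplicative, and $(a^\star)^\star = a$). The Jordan product on $A$ is $a \circ b = ab + ba$. *)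

(* Defs.v *)
From HB Require Import structures.
From mathcomp Require Import all_boot all_order all_algebra.
From mathcomp Require Import complex.
From mathcomp Require Import all_classical all_reals all_analysis.

Set Implicit Arguments.
Unset Strict Implicit.
Unset Printing Implicit Defensive.

Import Order.TTheory GRing.Theory Num.Theory.
Import numFieldNormedType.Exports.

Local Open Scope ring_scope.

(* Hierarchy Builder cannot join ring and normed-module structures below
   NumDomain, which already inherits from both. Hence the ring operations are
   fields of the mixin, and the ring structure is then declared as an instance.
   The ring is a pzRingType, not an algType, because the latter requires
   1 != 0; neither 1 != 0 nor `|1| = 1 is assumed here. *)
HB.mixin Record CompleteNormedModule_isBanachAlgebra (K : numFieldType) A
    of CompleteNormedModule K A := {
  banach_one : A ;
  banach_mul : A -> A -> A ;
  banach_mulA : associative banach_mul ;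
  banach_mul1l : left_id banach_one banach_mul ;
  banach_mul1r : right_id banach_one banach_mul ;
  banach_mulDl : left_distributive banach_mul +%R ;
  banach_mulDr : right_distributive banach_mul +%R ;
  banach_scalerAl : forall (k : K) (a b : A),
    k *: banach_mul a b = banach_mul (k *: a) b ;
  banach_scalerAr : forall (k : K) (a b : A),
    k *: banach_mul a b = banach_mul a (k *: b) ;
  banach_normM_le : forall a b : A, `|banach_mul a b| <= `|a| * `|b|
}.

#[short(type="banachAlgType")]
HB.structure Definition BanachAlgebra (K : numFieldType) :=
  {A of CompleteNormedModule K A & CompleteNormedModule_isBanachAlgebra K A}.

HB.instance Definition _ (K : numFieldType) (A : banachAlgType K) :=
  GRing.Zmodule_isPzRing.Build (BanachAlgebra.sort A)
    (@banach_mulA K A) (@banach_mul1l K A) (@banach_mul1r K A)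
    (@banach_mulDl K A) (@banach_mulDr K A).

(* An involution is not required to be isometric, or even continuous. *)
Record is_involution (K : numClosedFieldType) (A : banachAlgType K)
    (star : A -> A) : Prop := IsInvolution {
  starD : forall a b : A, star (a + b) = star a + star b ;
  starZ : forall (k : K) (a : A), star (k *: a) = k^* *: star a ;
  starM : forall a b : A, star (a * b) = star b * star a ;
  starK : forall a : A, star (star a) = a
}.

Definition jordan_mul (A : pzRingType) (a b : A) : A := a * b + b * a.

(* Main.v *)
Require Import Defs.
From HB Require Import structures.
From mathcomp Require Import all_boot all_order all_algebra.
From mathcomp Require Import complex.
From mathcomp Require Import all_classical all_reals all_analysis.

Set Implicit Arguments.
Unset Strict Implicit.
Unset Printing Implicit Defensive.

Import Order.TTheory GRing.Theory Num.Theory.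
Import numFieldNormedType.Exports.

Local Open Scope ring_scope.

(** Since the involution is a bijection, either hypothesis says just that
    [phi a c = phi 1 z] as soon as [a * c = z].  Invertible elements supply
    such pairs: for small scalars [t], the Neumann series gives a right inverse
    [y] of [1 - t *: a], and [(1 - t *: a) * (y * z) = z].  As
    [y = 1 + t *: (a * y)], bilinearity turns
    [phi (1 - t *: a) (y * z) = phi 1 z] into
    [t *: (phi 1 (a * (y * z)) - phi a (y * z)) = 0].  So the linear map
    [D w = phi 1 (a * w) - phi a w] (below, [defect a]) kills [y * z] for every small nonzero [t]
    ([resolvent_balanced]), and [y] tends to [1] with [t]
    ([resolvent_adherent1]): hence [D z = 0].  Then [D] also kills
    [a * (y * z)], the difference quotient of [y * z] and [z], and a second
    passage to the limit gives [D (a * z) = 0].  These two equations are the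
    identities claimed for [phi]; polarizing the quadratic one shows that
    [Phi c = phi 1 (c * z)] is the required linear map. *)

(** * Right inverses of small perturbations of the unit *)

Lemma complex_archi_bound (R : realType) (x : R[i]) :
  0 <= x -> exists n : nat, x < n%:R.
Proof.
move=> x0; exists (Num.bound (complex.Re x)).
rewrite -(RRe_real (ger0_real x0)) -(rmorph_nat (real_complex R)) ltcR.
by rewrite archi_boundP // -ler0c (RRe_real (ger0_real x0)).
Qed.

Section ResolventNearOne.
Variables (R : realType) (A : banachAlgType R[i]).
Implicit Types a b y z : A.

Lemma scale_mull (t : R[i]) (u v : A) : t *: (u * v) = (t *: u) * v.
Proof. exact: banach_scalerAl. Qed.

Lemma scale_mulr (t : R[i]) (u v : A) : t *: (u * v) = u * (t *: v).
Proof. exact: banach_scalerAr. Qed.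

Lemma banach_mull_continuous a : continuous (fun y : A => a * y).
Proof.
move=> y; apply/cvgrPdist_lt => e e0.
have M0 : 0 < 1 + `|a| by rewrite ltr_wpDr.
have d0 : 0 < e / (1 + `|a|) by rewrite divr_gt0.
near=> x.
rewrite -mulrBr; apply: le_lt_trans (banach_normM_le _ _) _.
apply: (@le_lt_trans _ _ ((1 + `|a|) * `|y - x|)).
  by rewrite ler_wpM2r // lerDr.
rewrite mulrC -ltr_pdivlMr; last by [].
near: x; exact: cvgr_dist_lt.
Unshelve. all: by end_near. Qed.

Lemma banach_mulr_continuous z : continuous (fun y : A => y * z).
Proof.
move=> y; apply/cvgrPdist_lt => e e0.
have M0 : 0 < 1 + `|z| by rewrite ltr_wpDr.
have d0 : 0 < e / (1 + `|z|) by rewrite divr_gt0.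
near=> x.
rewrite -mulrBl; apply: le_lt_trans (banach_normM_le _ _) _.
apply: (@le_lt_trans _ _ (`|y - x| * (1 + `|z|))).
  by rewrite ler_wpM2l // lerDr.
rewrite -ltr_pdivlMr; last by [].
near: x; exact: cvgr_dist_lt.
Unshelve. all: by end_near. Qed.

(** The [n]-th partial sum of the Neumann series of [b], in the recursive form
    that makes its limit a fixed point of [y |-> 1 + b * y]. *)
Definition neumann b (n : nat) : A := iter n (fun y => 1 + b * y) 0.

(** Induction on the recursion: [|1| + 2^-1 * (2 * |1|) = 2 * |1|].  The norm
    of the unit need not be [1], whence the factor. *)
Lemma neumann_bounded b n : `|b| <= 2^-1 -> `|neumann b n| <= 2 * `|1 : A|.
Proof.
move=> b2; elim: n => [|n IHn] /=; first by rewrite normr0 mulr_ge0.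
rewrite -/(neumann b n) (le_trans (ler_normD _ _)) //.
rewrite mulrDl mul1r lerD2l (le_trans (banach_normM_le _ _)) //.
by rewrite (le_trans (ler_pM _ _ b2 IHn)) // mulKf // pnatr_eq0.
Qed.

(** Each step of the recursion multiplies the difference by [b], down to
    [neumann b k - 0]. *)
Lemma neumann_tail b n k : `|b| <= 2^-1 ->
  `|neumann b (n + k) - neumann b n| <= (2^-1) ^+ n * (2 * `|1 : A|).
Proof.
move=> b2; elim: n => [|n IHn]; first by rewrite subr0 mul1r neumann_bounded.
rewrite addSn /= -/(neumann b _) -/(neumann b n) opprD addrACA subrr add0r.
rewrite -mulrBr (le_trans (banach_normM_le _ _)) // exprS -mulrA.
by rewrite ler_pM.
Qed.

Lemma neumann_cvg b : `|b| <= 2^-1 -> cvg (neumann b @ \oo)%classic.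
Proof.
move=> b2; apply/cauchy_cvgP/cauchy_exP => e e0.
set c : R[i] := 2 * `|1 : A|.
have [N cN] : exists N : nat, c / e < N%:R.
  by apply: complex_archi_bound; rewrite divr_ge0 ?mulr_ge0 // ltW.
exists (neumann b N); exists N => // n /= Nn.
rewrite -ball_normE /= distrC -(subnKC Nn).
apply: le_lt_trans (neumann_tail _ _ b2) _.
rewrite -/c exprVn mulrC ltr_pdivrMr ?exprn_gt0 // [e * _]mulrC -ltr_pdivrMr //.
by rewrite (lt_trans cN) // -natrX ltr_nat ltn_expl.
Qed.

(** The equation says that [y] is a right inverse of [1 - b]. *)
Lemma right_inverse_near1 b : `|b| <= 2^-1 ->
  exists2 y : A, y = 1 + b * y & `|y - 1| <= `|b| * (2 * `|1 : A|).
Proof.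
move=> b2; have /cvg_ex[y uy] := neumann_cvg b2.
have ybu : y = 1 + b * y.
  have vu : (neumann b n.+1 @[n --> \oo] --> 1 + b * y)%classic.
    apply: cvgD; first exact: cvg_cst.
    exact: (continuous_cvg _ (@banach_mull_continuous b y) uy).
  apply: (cvg_unique (@norm_hausdorff _ A) _ vu).
  by have := uy; rewrite -(cvg_shiftS (neumann b)).
exists y => //.
rewrite [in X in X - 1]ybu addrC addKr.
apply: le_trans (banach_normM_le _ _) _; rewrite ler_wpM2l //.
(* absorb half of the norm of [y] into the left-hand side *)
have : `|y| <= `|1 : A| + 2^-1 * `|y|.
  rewrite {1}ybu (le_trans (ler_normD _ _)) // lerD2l.
  by rewrite (le_trans (banach_normM_le _ _)) // ler_wpM2r.
rewrite -lerBlDr -{1}[`|y|]mul1r -mulrBl.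
have -> : 1 - 2^-1 = 2^-1 :> R[i] by rewrite {1}(splitr 1) mul1r addrK.
by rewrite mulrC ler_pdivrMr // mulrC.
Qed.

(** The right inverses of the elements [1 - t *: a], in fixed-point form.
    Nonzero [t] is what lets a factor [t] be cancelled later on; the limit at
    [t = 0] is only reached by adherence. *)
Definition resolvents a : set A :=
  [set y | exists2 t : R[i], t != 0 & y = 1 + t *: (a * y)]%classic.

Lemma resolvent_adherent1 a : closure (resolvents a) 1.
Proof.
move=> B /nbhs_ballP[e /= e0 eB].
(* [t = M^-1] is small enough both for convergence and for [e]-closeness *)
pose M : R[i] := 1 + `|a| * 2 + `|a| * (2 * `|1 : A|) / e.
have q0 : 0 <= `|a| * (2 * `|1 : A|) / e by rewrite divr_ge0 ?mulr_ge0 // ltW.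
have p0 : 0 <= `|a| * 2 by rewrite mulr_ge0.
have M0 : 0 < M by rewrite /M ltr_wpDr // ltr_wpDr.
have Ma : `|M^-1 *: a| = M^-1 * `|a| by rewrite normrZ gtr0_norm // invr_gt0.
have [|y yE y1] := @right_inverse_near1 (M^-1 *: a).
  rewrite Ma mulrC ler_pdivrMr // mulrC ler_pdivlMr //.
  by rewrite /M addrAC lerDr addr_ge0.
exists y; split.
  exists M^-1; first by rewrite invr_eq0 gt_eqF.
  by rewrite {1}yE; congr (_ + _); rewrite scale_mull.
apply: eB; rewrite -ball_normE /= distrC (le_lt_trans y1) // Ma.
rewrite -mulrA mulrC ltr_pdivrMr // [e * _]mulrC -ltr_pdivrMr //.
by rewrite /M ltrDr ltr_wpDr.
Qed.

(** The difference quotient of [y * z] and [z] is [a * (y * z)]; this is how a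
    statement of first order in [t] becomes one of second order. *)
Lemma resolvent_mulr a y z : resolvents a y ->
  exists2 t : R[i], t != 0 & y * z = z + t *: (a * (y * z)).
Proof.
move=> [t t0 yE]; exists t => //.
by rewrite {1}yE mulrDl mul1r mulrA -scale_mull.
Qed.

End ResolventNearOne.

Lemma continuous_eq0_closure (K : numFieldType) (T : topologicalType)
    (V : normedModType K) (f : T -> V) (S : set T) (p : T) :
  continuous f -> (forall y, S y -> f y = 0) -> closure S p -> f p = 0.
Proof.
move=> fc fS Sp.
have cl : closed (f @^-1` [set 0])%classic.
  apply: closed_comp; first by move=> x _; exact: fc.
  exact: (accessible_closed_set1 (hausdorff_accessible (@norm_hausdorff _ _))).
by apply: cl; apply: closure_subset Sp => y /fS.
Qed.

(** * Bilinear maps constant on the factorizations of an element *)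

Section ConstantOnFactorizations.
Variables (R : realType) (A : banachAlgType R[i]) (z : A).
Variables (X : completeNormedModType R[i]) (phi : {bilinear A -> A -> X}).
Hypothesis phi_cont : continuous (fun p : A * A => phi p.1 p.2).
Hypothesis phi_z : forall a c : A, a * c = z -> phi a c = phi 1 z.

Lemma bilinear_continuousr (a : A) : continuous (phi a).
Proof.
move=> x.
apply: (@continuous_comp _ _ _ (pair a) (fun p : A * A => phi p.1 p.2)).
  exact: cvg_pair (cvg_cst _) cvg_id.
exact: phi_cont.
Qed.

(** [1 - t *: a] and [y * z] are a factorization of [z]; the constant terms
    of the expansion in [t] cancel, and then so does [t]. *)
Lemma resolvent_balanced (a y : A) : resolvents a y ->
  phi 1 (a * (y * z)) = phi a (y * z).
Proof.
move=> ay; have [t t0 yzE] := resolvent_mulr z ay.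
have : phi (1 - t *: a) (y * z) = phi 1 z.
  apply: phi_z; rewrite mulrBl mul1r {1}yzE.
  by rewrite -scale_mull addrK.
rewrite linearBl linearZl_LR {1}yzE linearDr linearZr_LR /= -addrA -scalerBr.
rewrite -[RHS]addr0 => /addrI/eqP.
by rewrite scaler_eq0 (negPf t0) subr_eq0 => /eqP.
Qed.

(** The failure of [phi] to let [a] pass from its left to its right argument
    when the other factors are [1] and [w]. *)
Definition defect (a w : A) : X := phi 1 (a * w) - phi a w.

Lemma defect_continuous (a : A) : continuous (defect a).
Proof.
move=> w; apply: cvgB; last exact: bilinear_continuousr.
apply: continuous_comp; first exact: banach_mull_continuous.
exact: bilinear_continuousr.
Qed.

Lemma defectDZ (a u v : A) (t : R[i]) :
  defect a (u + t *: v) = defect a u + t *: defect a v.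
Proof.
rewrite /defect mulrDr -[a * (t *: v)]scale_mulr !linearDr !linearZr_LR /=.
by rewrite opprD addrACA scalerBr.
Qed.

Lemma defect_resolvent (a y : A) : resolvents a y -> defect a (y * z) = 0.
Proof. by move=> /resolvent_balanced yz; rewrite /defect yz subrr. Qed.

Lemma defect_eq0 (a : A) : defect a z = 0.
Proof.
rewrite -[z in LHS]mul1r.
apply: (continuous_eq0_closure (f := fun y : A => defect a (y * z)) _
  (@defect_resolvent a) (@resolvent_adherent1 R A a)).
move=> y; apply: (@continuous_comp _ _ _ (fun y : A => y * z) (defect a)).
  exact: banach_mulr_continuous.
exact: defect_continuous.
Qed.

(** For a resolvent [y], [defect a] vanishes at [y * z] and, by [defect_eq0],
    at [z]; so it vanishes at the difference quotient [a * (y * z)], and [y] may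
    then tend to [1]. *)
Lemma defect_mul_eq0 (a : A) : defect a (a * z) = 0.
Proof.
rewrite -[z in LHS]mul1r.
apply: (continuous_eq0_closure (f := fun y : A => defect a (a * (y * z))) _
  _ (@resolvent_adherent1 R A a)).
  move=> y.
  apply: (@continuous_comp _ _ _ (fun y : A => y * z)
                                 (fun w => defect a (a * w))).
    exact: banach_mulr_continuous.
  apply: (@continuous_comp _ _ _ (fun w : A => a * w) (defect a)).
    exact: banach_mull_continuous.
  exact: defect_continuous.
move=> y ay; have [t t0 yzE] := resolvent_mulr z ay.
have /eqP := defect_resolvent ay; rewrite [in X in X -> _]yzE.
rewrite defectDZ defect_eq0 add0r.
by rewrite scaler_eq0 (negPf t0) => /eqP.
Qed.

Lemma eval1_mulr (a : A) : phi 1 (a * z) = phi a z.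
Proof. by apply/eqP; rewrite -subr_eq0; apply/eqP/defect_eq0. Qed.

Lemma eval1_sqr (a : A) : phi 1 (a * (a * z)) = phi a (a * z).
Proof. by apply/eqP; rewrite -subr_eq0; apply/eqP/defect_mul_eq0. Qed.

(** Polarization of [eval1_sqr]. *)
Lemma eval1_jordan (a b : A) :
  phi a (b * z) + phi b (a * z) = phi 1 (jordan_mul a b * z).
Proof.
have sqE : (a + b) * ((a + b) * z)
         = (a * (a * z) + b * (b * z)) + jordan_mul a b * z.
  rewrite /jordan_mul !mulrA -!mulrDl; congr (_ * z).
  by rewrite mulrDl !mulrDr [X in _ + X = _]addrC addrACA.
have := eval1_sqr (a + b); rewrite sqE !linearDr /= !eval1_sqr [(a + b) * z]mulrDl.
rewrite linearDl !linearDr /= [X in _ = _ + X -> _]addrC addrACA.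
by move=> /addrI ->.
Qed.

Lemma eval1_linear : linear (fun c : A => phi 1 (c * z)).
Proof. by move=> k u v; rewrite mulrDl linearDr -scale_mull linearZr_LR. Qed.

End ConstantOnFactorizations.

Theorem mainTheorem3 (R : realType) (A : banachAlgType R[i])
    (star : A -> A) (star_inv : is_involution star) (z : A)
    (X : completeNormedModType R[i]) (phi : {bilinear A -> A -> X})
    (phi_cont : continuous (fun p : A * A => phi p.1 p.2))
    (phi_z :
      (forall a b : A, a * star b = z -> phi a (star b) = phi 1 z) \/
      (forall a b : A, star a * b = z -> phi (star a) b = phi 1 z)) :
  (forall a : A,
      phi a (a * z) = phi 1 (a ^+ 2 * z) /\ phi 1 (a * z) = phi a z) /\
  exists Phi : {linear A -> X},
    continuous Phi /\
    forall a b : A, phi a (b * z) + phi b (a * z) = Phi (jordan_mul a b).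
Proof.
have phiz (a c : A) : a * c = z -> phi a c = phi 1 z.
  case: phi_z => H.
    by rewrite -(starK star_inv c); exact: H.
  by rewrite -(starK star_inv a); exact: H.
split=> [a|].
  by rewrite expr2 -mulrA (eval1_sqr phi_cont phiz) (eval1_mulr phi_cont phiz).
pose f := fun c : A => phi 1 (c * z).
pose Lf := GRing.isLinear.Build _ _ _ _ f (eval1_linear z phi).
exists (HB.pack_for {linear A -> X} f Lf); split=> [c|a b].
  apply: (@continuous_comp _ _ _ (fun c : A => c * z) (phi 1)).
    exact: banach_mulr_continuous.
  exact: bilinear_continuousr.
exact: eval1_jordan.
Qed.
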